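(* For any fixed $\epsilon>0$, the $\epsilon$-\textsc{MFS} problem can be solved in $n^{O(\log n)}$ steps, where $n$ is the input size.
   Context: Let $\Delta_{m}$ denote the set of probability vectors in $\mathbb{R}^{m}$. $\epsilon$-\textsc{MFS} (maximum $\epsilon$-feasible subsystem of linear inequalities): given a matrix $A\in[-1,1]^{n_{\text{row}}\times n_{\text{col}}}$, let $\mathbf{x}^\ast\in\Delta_{n_{\text{col}}}$ be a probability vector maximizing $k^\ast=\sum_{i\in[n_{\text{row}}]}I[w^\ast_i\ge0]$ where $\mathbf{w}^\ast=A\mathbf{x}^\ast$ ($I$ is the indicator function). The task is to find a probability vector $\mathbf{x}\in\Delta_{n_{\text{col}}}$ such that, with $\mathbf{w}=A\mathbf{x}$, $\sum_{i\in[n_{\text{row}}]}I[w_i\ge-\epsilon]\ge k^\ast$. *)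

(* Defs.v *)
(* A real-RAM (BSS-style) machine model with unit-cost
   operations, used to give meaning to "solved in n^{O(log n)} steps". *)
From HB Require Import structures.
From mathcomp Require Import all_boot all_order all_algebra.
From mathcomp Require Import reals.
Set Implicit Arguments. Unset Strict Implicit. Unset Printing Implicit Defensive.
Import Order.TTheory GRing.Theory Num.Theory.
Local Open Scope ring_scope.

Section RealRAM.
Variable R : realType.

Record state := State { nmem : nat -> nat ; rmem : nat -> R }.

Definition upd {T : Type} (f : nat -> T) (a : nat) (v : T) : nat -> T :=
  fun x => if x == a then v else f x.

(* Basic (unit-cost) instructions.  No nat multiplication / division and no
   real-to-integer conversion (floor), as in the standard real RAM. *)
Inductive basic :=
| NConst of nat & nat
| NAdd of nat & nat & nat
| NSub of nat & nat & nat
| NLoad of nat & nat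
| NStore of nat & nat
| RConst of nat & R
| RAdd of nat & nat & nat
| RSub of nat & nat & nat
| RMul of nat & nat & nat
| RDiv of nat & nat & nat
| RLoad of nat & nat
| RStore of nat & nat
| NtoR of nat & nat
| RInput of nat & nat & nat.

Inductive cond :=
| CNle of nat & nat | CNlt of nat & nat | CRle of nat & nat | CRlt of nat & nat.

Inductive prog :=
| Basic of basic
| Seq of prog & prog
| If of cond & prog & prog
| While of cond & prog.

Definition entry (nr nc : nat) (A : 'M[R]_(nr, nc)) (a b : nat) : R :=
  match insub a, insub b with
  | Some i, Some j => A i j
  | _, _ => 0
  end.

Definition run_basic nr nc (A : 'M[R]_(nr, nc)) (b : basic) (s : state) : state :=
  let nm := nmem s in let rm := rmem s in
  match b with
  | NConst d c => State (upd nm d c) rm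
  | NAdd d a b => State (upd nm d (nm a + nm b)%N) rm
  | NSub d a b => State (upd nm d (nm a - nm b)%N) rm
  | NLoad d a => State (upd nm d (nm (nm a))) rm
  | NStore a s => State (upd nm (nm a) (nm s)) rm
  | RConst d r => State nm (upd rm d r)
  | RAdd d a b => State nm (upd rm d (rm a + rm b))
  | RSub d a b => State nm (upd rm d (rm a - rm b))
  | RMul d a b => State nm (upd rm d (rm a * rm b))
  | RDiv d a b => State nm (upd rm d (rm a / rm b))
  | RLoad d a => State nm (upd rm d (rm (nm a)))
  | RStore a s => State nm (upd rm (nm a) (rm s))
  | NtoR d a => State nm (upd rm d (nm a)%:R)
  | RInput d a b => State nm (upd rm d (entry A (nm a) (nm b)))
  end.

Definition eval_cond (c : cond) (s : state) : bool :=
  match c with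
  | CNle a b => (nmem s a <= nmem s b)%N
  | CNlt a b => (nmem s a < nmem s b)%N
  | CRle a b => rmem s a <= rmem s b
  | CRlt a b => rmem s a < rmem s b
  end.

Inductive exec nr nc (A : 'M[R]_(nr, nc)) : prog -> state -> nat -> state -> Prop :=
| ExBasic b s : exec A (Basic b) s 1 (run_basic A b s)
| ExSeq p q s t1 s1 t2 s2 :
    exec A p s t1 s1 -> exec A q s1 t2 s2 -> exec A (Seq p q) s (t1 + t2) s2
| ExIfT c p q s t s' :
    eval_cond c s -> exec A p s t s' -> exec A (If c p q) s t.+1 s'
| ExIfF c p q s t s' :
    ~~ eval_cond c s -> exec A q s t s' -> exec A (If c p q) s t.+1 s'
| ExWhileF c p s : ~~ eval_cond c s -> exec A (While c p) s 1 s
| ExWhileT c p s t1 s1 t2 s2 :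
    eval_cond c s -> exec A p s t1 s1 -> exec A (While c p) s1 t2 s2 ->
    exec A (While c p) s (t1 + t2).+1 s2.

(* Initial state: nm[0] = number of rows, nm[1] = number of columns,
   everything else 0.  The output is read from rm[0 .. nc-1]. *)
Definition init_state (nr nc : nat) : state :=
  State (fun a => if a == 0%N then nr else if a == 1%N then nc else 0%N)
        (fun _ => 0).

End RealRAM.

Definition in_simplex (R : realType) (n : nat) (x : 'I_n -> R) : Prop :=
  (forall j, 0 <= x j) /\ \sum_(j < n) x j = 1.

Definition mxapp (R : realType) (nr nc : nat) (A : 'M[R]_(nr, nc))
  (x : 'I_nc -> R) (i : 'I_nr) : R := \sum_(j < nc) A i j * x j.

Definition nsat (R : realType) (nr nc : nat) (A : 'M[R]_(nr, nc))
  (x : 'I_nc -> R) (eps : R) : nat :=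
  #|[set i : 'I_nr | - eps <= mxapp A x i]|.

Definition eps_MFS_solution (R : realType) (nr nc : nat) (A : 'M[R]_(nr, nc))
  (eps : R) (x : 'I_nc -> R) : Prop :=
  in_simplex x /\
  forall y : 'I_nc -> R, in_simplex y -> (nsat A y 0 <= nsat A x eps)%N.

(* Main.v *)
Require Import Defs.
From HB Require Import structures.
From mathcomp Require Import all_boot all_order all_algebra.
From mathcomp Require Import boolp reals.
From mathcomp Require Import zify ring lra.
Import Order.TTheory GRing.Theory Num.Theory.
Local Open Scope ring_scope.

(* Sparsification: if x is a probability vector and k = K * (log2 nr + 1) with K
   depending only on eps, some k-uniform average x' of unit vectors satisfies
   (A x')_i >= (A x)_i - eps for every row i.  The columns are chosen greedily:
   averaging against x shows that the potential
   sum_i prod_t (1 - lam * (A_{i,j_t} - (A x)_i)) can be kept at most nr, while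
   AM-GM applied to the reciprocals of the factors shows that a row losing more
   than eps would have a product exceeding nr.  It therefore suffices to try
   all nc^k = n^{O(log n)} column sequences.  The machine enumerates them without
   arrays, as the base-nc digits of a counter N < nc^k, and outputs the digit
   frequencies of the best N. *)

(** * Sparsification *)

(** Otherwise the vanishing sum of [y j * (f j - m)], with [m] the mean, has only nonnegative terms,
    which forces [y = 0]. *)
Lemma simplex_exists_le_mean (R : realType) n (y f : 'I_n -> R) : in_simplex y ->
  exists j, f j <= \sum_(j < n) y j * f j.
Proof.
move=> [y0 y1]; apply: contrapT => /forallNP H.
set m := \sum_(j < n) _ in H.
have H' j : m < f j by rewrite ltNge; apply/negP.
have : \sum_(j < n) y j * (f j - m) = 0.
  under eq_bigr do rewrite mulrBr.
  by rewrite sumrB -mulr_suml y1 mul1r subrr.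
move/eqP; rewrite psumr_eq0 => [/allP H0|j _]; last first.
  by rewrite mulr_ge0 // subr_ge0 ltW.
have : \sum_(j < n) y j = 0.
  rewrite big1 // => j _; have := H0 j (mem_index_enum _).
  by rewrite mulf_eq0 subr_eq0 (gt_eqF (H' j)) orbF => /eqP.
by rewrite y1 => /eqP; rewrite oner_eq0.
Qed.

Definition deviation {R : realType} {nr nc} (A : 'M[R]_(nr, nc)) (y : 'I_nc -> R)
  (i : 'I_nr) (j : 'I_nc) : R := A i j - mxapp A y i.

Lemma deviation_bound {R : realType} {nr nc} (A : 'M[R]_(nr, nc)) y i j :
  (forall i j, -1 <= A i j <= 1) -> in_simplex y -> `|deviation A y i j| <= 2.
Proof.
move=> hA [y0 y1].
have aA i' j' : `|A i' j'| <= 1 by rewrite ler_norml.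
have w1 : `|mxapp A y i| <= 1.
  apply: le_trans (ler_norm_sum _ _ _) _; rewrite -y1; apply: ler_sum => j' _.
  by rewrite normrM (ger0_norm (y0 _)) ler_piMl.
apply: le_trans (ler_normB _ _) _; have := aA i j; lra.
Qed.

(** Method of conditional expectations: under [y] each deviation has mean 0, so a fresh factor has
    mean 1 and some column does not increase the potential. *)
Lemma potential_sequence {R : realType} {nr nc} (A : 'M[R]_(nr, nc)) y (lam : R) k :
  (forall i j, -1 <= A i j <= 1) -> in_simplex y -> 0 <= lam <= 2^-1 ->
  exists g : nat -> 'I_nc,
    \sum_(i < nr) \prod_(t < k) (1 - lam * deviation A y i (g t)) <= nr%:R.
Proof.
move=> hA hy /andP[l0 l1].
have pos i j : 0 <= 1 - lam * deviation A y i j.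
  have := deviation_bound A y i j hA hy; rewrite ler_norml => /andP[_ d2].
  nra.
elim: k => [|k [g IH]].
  (* A probability vector forces some column to exist; the empty products sum to exactly [nr]. *)
  have [j _] := simplex_exists_le_mean _ _ _ (fun=> 0) hy.
  by exists (fun=> j); under eq_bigr do rewrite big_ord0; rewrite sumr_const card_ord.
pose Phi i := \prod_(t < k) (1 - lam * deviation A y i (g t)).
pose F j := \sum_(i < nr) Phi i * (1 - lam * deviation A y i j).
have [j Fj] := simplex_exists_le_mean _ _ y F hy.
exists (fun t => if t == k then j else g t).
apply: le_trans IH; apply: le_trans (le_trans Fj _).
  apply: ler_sum => i _; rewrite big_ord_recr /= eqxx.
  rewrite (eq_bigr (fun t : 'I_k => 1 - lam * deviation A y i (g t))) // => t _.
  by rewrite (ltn_eqF (ltn_ord t)).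
have [y0 y1] := hy.
rewrite /F; under eq_bigr do rewrite mulr_sumr.
rewrite exchange_big /=; apply: ler_sum => i _.
under eq_bigr do rewrite mulrCA.
rewrite -mulr_sumr -/(Phi i).
suff -> : \sum_(j < nc) y j * (1 - lam * deviation A y i j) = 1 by rewrite mulr1.
rewrite (eq_bigr (fun j => y j * (1 + lam * mxapp A y i) - lam * (A i j * y j))).
  by rewrite sumrB -mulr_suml -mulr_sumr y1 -/(mxapp A y i); ring.
by move=> j' _; rewrite /deviation; ring.
Qed.

(** AM-GM bounds the product by the [k]-th power of the mean reciprocal. That mean is at most 1,
    plus [lam] times the mean of [d], plus [2 * (2 * lam) ^+ 2]. *)
Lemma prod_inv_le_expn {R : realType} (lam e : R) k (d : nat -> R) : (0 < k)%N ->
  0 <= lam <= 4^-1 -> (forall t, `|d t| <= 2) ->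
  \sum_(t < k) d t <= - e * k%:R ->
  \prod_(t < k) (1 - lam * d t)^-1 <= (1 - lam * e + 8 * lam ^+ 2) ^+ k.
Proof.
move=> k0 /andP[l0 l1] hd hs.
have hz t : lam * d t <= 2^-1.
  have := hd t; rewrite ler_norml => /andP[_ d2]; nra.
(* 1/(1-z) <= 1 + z + 2z^2 for z <= 1/2, with z = lam * d t *)
have inv t : 0 <= (1 - lam * d t)^-1 <= 1 + lam * d t + 8 * lam ^+ 2.
  have p : 0 < 1 - lam * d t by have := hz t; lra.
  rewrite invr_ge0 (ltW p) /= -[leLHS]mul1r ler_pdivrMr //.
  have d4 : d t ^+ 2 <= 4.
    have := hd t; rewrite ler_norml => /andP[d1 d2].
    suff : 0 <= (2 - d t) * (2 + d t) by lra.
    by rewrite mulr_ge0; lra.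
  have := hz t; set z := lam * d t => z2.
  have z8 : z ^+ 2 <= 4 * lam ^+ 2 by rewrite /z exprMn mulrC ler_pM // ?sqr_ge0.
  have := sqr_ge0 z => z0.
  apply: (@le_trans _ _ ((1 + z + 2 * z ^+ 2) * (1 - z))).
    suff : 0 <= z ^+ 2 * (1 - 2 * z) by lra.
    by rewrite mulr_ge0 //; lra.
  by rewrite ler_pM2r //; lra.
have kn0 : (0 : R) < k%:R by rewrite ltr0n.
have avg0 : 0 <= \sum_(t < k) (1 - lam * d t)^-1 / k%:R.
  by apply: sumr_ge0 => t _; rewrite divr_ge0 ?(ltW kn0) //; case/andP: (inv t).
have avgle : \sum_(t < k) (1 - lam * d t)^-1 / k%:R <= 1 - lam * e + 8 * lam ^+ 2.
  rewrite -mulr_suml ler_pdivrMr //.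
  apply: (@le_trans _ _ (\sum_(t < k) (1 + lam * d t + 8 * lam ^+ 2))).
    by apply: ler_sum => t _; case/andP: (inv t).
  rewrite !big_split /= -mulr_sumr !sumr_const card_ord -[in leLHS](mulr_natr (8 * _)).
  by have := ler_wpM2l l0 hs; lra.
apply: le_trans (_ : (\sum_(t < k) (1 - lam * d t)^-1 / k%:R) ^+ k <= _).
  rewrite -mulr_suml.
  have inv0 : {in 'I_k, forall t : 'I_k, 0 <= (1 - lam * d t)^-1}.
    by move=> t _; case/andP: (inv t).
  by have := leif_AGM inv0; rewrite card_ord; case.
by apply: lerXn2r; rewrite // nnegrE // (le_trans avg0).
Qed.

(** The choice [lam = e / 16] minimises [1 - lam * e + 8 * lam ^+ 2], with value [1 - e ^+ 2 / 32].
    A row losing more than [e] would alone contribute more than [nr] to the potential. *)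
Lemma sparse_sequence {R : realType} {nr nc} (A : 'M[R]_(nr, nc)) y (e : R) k :
  (forall i j, -1 <= A i j <= 1) -> in_simplex y -> 0 < e <= 1 -> (0 < k)%N ->
  nr%:R * (1 - e ^+ 2 / 32) ^+ k < 1 ->
  exists g : nat -> 'I_nc,
    forall i, (mxapp A y i - e) * k%:R <= \sum_(t < k) A i (g t).
Proof.
move=> hA hy /andP[e0 e1] k0 hk.
have l01 : 0 <= e / 16 <= 4^-1 by lra.
have [|g hg] := potential_sequence A y (e / 16) k hA hy; first by lra.
exists g => i; rewrite leNgt; apply/negP => hlt.
pose d t := deviation A y i (g t).
have hd t : `|d t| <= 2 by exact: deviation_bound.
have pos i' t : 0 < 1 - e / 16 * deviation A y i' (g t).
  have := deviation_bound A y i' (g t) hA hy; rewrite ler_norml => /andP[_ d2].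
  nra.
have hsum : \sum_(t < k) d t <= - e * k%:R.
  rewrite sumrB sumr_const card_ord -mulr_natr; lra.
have := prod_inv_le_expn _ e k d k0 l01 hd hsum.
have -> : 1 - e / 16 * e + 8 * (e / 16) ^+ 2 = 1 - e ^+ 2 / 32 by field.
rewrite prodfV => hinv.
have P0 : 0 < \prod_(t < k) (1 - e / 16 * d t) by apply: prodr_gt0 => t _; exact: pos.
have Pn : \prod_(t < k) (1 - e / 16 * d t) <= nr%:R.
  apply: le_trans hg; rewrite (bigD1 i) //= lerDl.
  by apply: sumr_ge0 => i' _; apply: prodr_ge0 => t _; apply: ltW.
have n0 : (0 : R) < nr%:R by apply: lt_le_trans P0 Pn.
have := le_lt_trans (ler_wpM2l (ltW n0) hinv) hk.
by rewrite ltr_pdivrMr // mul1r ltNge Pn.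
Qed.

(** Bernoulli's inequality for [h = q^-1]: [h ^+ K >= 1 + (h - 1) *+ K >= 2] for an Archimedean
    choice of [K]. *)
Lemma expn_decay_rate {R : realType} (q : R) : 0 < q < 1 ->
  exists2 K, (0 < K)%N & q ^+ K <= 2^-1.
Proof.
move=> /andP[q0 q1].
have [K hK] : exists K, 1 <= (q^-1 - 1) *+ K.
  pose x := (q^-1 - 1)^-1.
  have h0 : 0 < q^-1 - 1 by rewrite subr_gt0 invf_gt1.
  exists (Num.bound x); rewrite -mulr_natr -ler_pdivrMl // mulr1.
  by apply/ltW/archi_boundP; rewrite invr_ge0 ltW.
exists K.
  by case: K hK => //; rewrite mulr0n ler10.
rewrite -[q]invrK exprVn lef_pV2 ?posrE ?exprn_gt0 ?invr_gt0 //.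
set h := q^-1 in hK *.
have h1 : 1 < h by rewrite invf_gt1.
suff B n : 1 + (h - 1) *+ n <= h ^+ n by apply: le_trans (B K); lra.
elim: n => [|n IHn]; first by rewrite mulr0n addr0 expr0.
rewrite exprS mulrSr; set u := _ *+ n in IHn *.
have u0 : 0 <= u by rewrite mulrn_wge0 //; lra.
have : h * (1 + u) <= h * h ^+ n by rewrite ler_pM2l //; lra.
nra.
Qed.

(** * Bounded-time runs of the real RAM *)

(** Time is only bounded above, so that branches and iterations of unequal cost compose. *)
Definition runs {R : realType} {nr nc : nat} (A : 'M[R]_(nr, nc)) (p : prog R)
  (s : state R) (T : nat) (s' : state R) : Prop :=
  exists2 t, (t <= T)%N & exec A p s t s'.

Lemma runs_leq {R : realType} {nr nc} (A : 'M[R]_(nr, nc)) p s T T' s' :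
  (T <= T')%N -> runs A p s T s' -> runs A p s T' s'.
Proof. by move=> TT' [t tT ex]; exists t => //; apply: leq_trans TT'. Qed.

Lemma runs_seq {R : realType} {nr nc} (A : 'M[R]_(nr, nc)) p q s1 s2 s3 T1 T2 :
  runs A p s1 T1 s2 -> runs A q s2 T2 s3 -> runs A (Seq p q) s1 (T1 + T2) s3.
Proof.
by move=> [t1 h1 e1] [t2 h2 e2]; exists (t1 + t2)%N; [exact: leq_add|apply: ExSeq e1 e2].
Qed.

Lemma runs_if {R : realType} {nr nc} (A : 'M[R]_(nr, nc)) c p q s T s' :
  (eval_cond c s -> runs A p s T s') -> (~~ eval_cond c s -> runs A q s T s') ->
  runs A (If c p q) s T.+1 s'.
Proof.
move=> hp hq; have [/[dup] cs /hp|/[dup] cs /hq] := boolP (eval_cond c s).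
  by move=> [t tT e]; exists t.+1 => //; apply: ExIfT.
by move=> [t tT e]; exists t.+1 => //; apply: ExIfF.
Qed.

(** [S i] is the state after [i] rounds. Each round pays for its test; the outer successor pays for
    the last, failing one. *)
Lemma runs_while {R : realType} {nr nc} (A : 'M[R]_(nr, nc)) c p m T (S : nat -> state R) :
  (forall i, (i < m)%N -> eval_cond c (S i) /\ runs A p (S i) T (S i.+1)) ->
  ~~ eval_cond c (S m) ->
  runs A (While c p) (S 0%N) (m * T.+1).+1 (S m).
Proof.
elim: m S => [|m IH] S body stop; first by exists 1%N => //; apply: ExWhileF.
have [c0 [t0 t0T e0]] := body 0%N isT.
have [|t tT e] := IH (fun i => S i.+1) _ stop; first by move=> i im; apply: (body i.+1).
by exists (t0 + t).+1; [lia|apply: ExWhileT e0 e].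
Qed.

(** The first instruction is separate because [prog] has no empty program. *)
Definition block {R : realType} (b : basic R) (l : seq (basic R)) : prog R :=
  foldl (fun p b => Seq p (Basic b)) (Basic b) l.

Lemma runs_block {R : realType} {nr nc} (A : 'M[R]_(nr, nc)) b l s T s' :
  (size l < T)%N -> foldl (fun s b => run_basic A b s) s (b :: l) = s' ->
  runs A (block b l) s T s'.
Proof.
move=> lT <-; apply: runs_leq lT _.
elim/last_ind: l => [|l b' IH]; first by exists 1%N => //; apply: ExBasic.
rewrite /block size_rcons -cats1 -cat_cons !foldl_cat /= -[(size l).+2]addn1.
by apply: runs_seq IH _; exists 1%N => //; apply: ExBasic.
Qed.

Lemma updE {T : Type} (x0 : T) l a v : upd (nth x0 l) a v = nth x0 (set_nth x0 l a v).
Proof. by apply/funext => i; rewrite /upd nth_set_nth. Qed.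

(* Register use in all programs below: 0 = nr, 1 = nc, 2 = 1, 3 = k, 4 = nc^k,
   5 = current N, 6 = row or column index, 7 and 8 = remainder and quotient of
   the digit extraction, 9 = counter, 10 and 11 = best value and its N,
   12 = digit index, 13 = 0 (so that [NAdd d a 13] copies).  Real registers:
   0 = accumulator, 1 = scratch, 2 = the threshold [- eps * k]. *)
Definition St {R : realType} (l : seq nat) (f : nat -> R) : state R :=
  State (nth 0%N l) f.

Ltac straight := apply: runs_block => //; rewrite /= ?updE /= ?updE.

(** * Digit extraction and evaluation of one candidate *)

(** Repeated subtraction, as the machine cannot divide naturals. Linear time is affordable because
    the dividends stay below [nc ^ k]. *)
Definition divmod_prog (R : realType) : prog R :=
  Seq (Basic (NConst R 8 0))
    (While (CNle 1 7) (block (NSub R 7 7 1) [:: NAdd R 8 8 2])).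

Lemma runs_divmod {R : realType} {nr nc} (A : 'M[R]_(nr, nc))
    d a0 a3 a4 a5 a6 v a8 a9 a10 a11 a12 a13 (f : nat -> R) : (0 < d)%N ->
  runs A (divmod_prog R)
    (St [:: a0; d; 1; a3; a4; a5; a6; v; a8; a9; a10; a11; a12; a13]%N f) (3 * v + 2)
    (St [:: a0; d; 1; a3; a4; a5; a6; v %% d; v %/ d; a9; a10; a11; a12; a13]%N f).
Proof.
move=> d0.
apply: (@runs_leq _ _ _ _ _ _ (1 + ((v %/ d) * 3).+1)).
  by have := leq_div v d; lia.
pose S i := St [:: a0; d; 1; a3; a4; a5; a6; v - i * d; i; a9; a10; a11; a12; a13]%N f.
have -> : (v %% d = v - v %/ d * d)%N by rewrite {2}(divn_eq v d) addKn.
apply: (@runs_seq _ _ _ _ _ _ _ (S 0%N)).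
  by apply: (@runs_block _ _ _ _ _ [::]) => //; rewrite /= updE /S subn0.
apply: (@runs_while _ _ _ _ _ _ _ _ S) => [i iv|/=]; last first.
  by rewrite {1}(divn_eq v d) addKn -ltnNge ltn_mod.
split.
  have : (i.+1 * d <= v)%N by rewrite -leq_divRL.
  by rewrite /=; lia.
straight; rewrite /S /St.
by rewrite -subnDA addnC -mulSn addn1.
Qed.

Definition digit (d N t : nat) : nat := (N %/ d ^ t) %% d.

Definition row_sum {R : realType} {nr nc} (A : 'M[R]_(nr, nc)) (k N i : nat) : R :=
  \sum_(t < k) entry A i (digit nc N t).

(** At the head of the loop registers 7 and 8 both hold [N %/ nc ^ t]; the remainder then left in 7
    addresses the column. The last block clears the scratch registers for the next call. *)
Definition row_sum_prog (R : realType) : prog R :=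
  Seq (block (RConst 0 0) [:: NAdd R 7 5 13; NAdd R 8 5 13; NConst R 12 0])
  (Seq (While (CNlt 12 3) (Seq (divmod_prog R)
     (block (RInput R 1 6 7) [:: RAdd R 0 0 1; RConst 1 0; NAdd R 7 8 13; NAdd R 12 12 2])))
  (block (NConst R 7 0) [:: NConst R 8 0; NConst R 12 0])).

Lemma runs_row_sum {R : realType} {nr nc} (A : 'M[R]_(nr, nc))
    k L N i cnt best bestN (r thr : R) : (0 < nc)%N ->
  runs A (row_sum_prog R)
    (St [:: nr; nc; 1; k; L; N; i; 0; 0; cnt; best; bestN; 0; 0]%N (nth 0 [:: r; 0; thr]))
    (k * (3 * N + 8) + 8)
    (St [:: nr; nc; 1; k; L; N; i; 0; 0; cnt; best; bestN; 0; 0]%N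
      (nth 0 [:: row_sum A k N i; 0; thr])).
Proof.
move=> nc0.
pose S t := St [:: nr; nc; 1; k; L; N; i; N %/ nc ^ t; N %/ nc ^ t; cnt; best; bestN; t; 0]%N
   (nth 0 [:: row_sum A t N i; 0; thr]).
apply: (@runs_leq _ _ _ _ _ _ (4 + ((k * (3 * N + 7).+1).+1 + 3))); first by lia.
apply: (@runs_seq _ _ _ _ _ _ _ (S 0%N)).
  straight; rewrite /S /St /row_sum big_ord0 expn0 divn1 ?addn0 //.
apply: (@runs_seq _ _ _ _ _ _ _ (S k)); last by straight.
apply: (@runs_while _ _ _ _ _ _ _ _ S) => [t tk|]; last by rewrite /= ltnn.
split=> //; rewrite {1}/S.
apply: (@runs_leq _ _ _ _ _ _ (3 * (N %/ nc ^ t) + 2 + 5)).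
  by have := leq_div N (nc ^ t); lia.
apply: runs_seq; first exact: runs_divmod.
straight; rewrite /S /St /row_sum big_ord_recr /= expnSr divnMA !addn0 addn1 //.
Qed.

(** For [n = nr] and [thr = - eps * k] this is [nsat] of the digit frequencies of [N]; scaling by
    [k] avoids divisions. *)
Definition row_val {R : realType} {nr nc} (A : 'M[R]_(nr, nc)) (thr : R) (k n N : nat) : nat :=
  \sum_(i < n) (thr <= row_sum A k N i)%R.

(** A no-op, since register 13 already holds 0. *)
Definition skip (R : realType) : prog R := block (NConst R 13 0) [::].

Definition value_prog (R : realType) : prog R :=
  Seq (block (NConst R 9 0) [:: NConst R 6 0])
  (Seq (While (CNlt 6 0) (Seq (row_sum_prog R)
     (Seq (If (CRle 2 0) (block (NAdd R 9 9 2) [::]) (skip R))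
        (block (NAdd R 6 6 2) [::]))))
   (block (NConst R 6 0) [:: RConst 0 0])).

Lemma runs_value {R : realType} {nr nc} (A : 'M[R]_(nr, nc))
    k L N cnt best bestN (thr : R) : (0 < nc)%N ->
  runs A (value_prog R)
    (St [:: nr; nc; 1; k; L; N; 0; 0; 0; cnt; best; bestN; 0; 0]%N (nth 0 [:: 0; 0; thr]))
    (nr * (k * (3 * N + 8) + 12) + 5)
    (St [:: nr; nc; 1; k; L; N; 0; 0; 0; row_val A thr k nr N; best; bestN; 0; 0]%N
      (nth 0 [:: 0; 0; thr])).
Proof.
move=> nc0.
(* Real register 0 keeps the sum of the previous row until [row_sum_prog] resets it, hence the case
   split on [i]. *)
pose S i := St [:: nr; nc; 1; k; L; N; i; 0; 0; row_val A thr k i N; best; bestN; 0; 0]%N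
   (nth 0 [:: if i is i'.+1 then row_sum A k N i' else 0; 0; thr]).
apply: (@runs_leq _ _ _ _ _ _ (2 + ((nr * (k * (3 * N + 8) + 8 + (2 + 1)).+1).+1 + 2))).
  by lia.
apply: (@runs_seq _ _ _ _ _ _ _ (S 0%N)).
  by straight; rewrite /S /St /row_val big_ord0.
apply: (@runs_seq _ _ _ _ _ _ _ (S nr)); last by straight.
apply: (@runs_while _ _ _ _ _ _ _ _ S) => [i ilt|]; last by rewrite /= ltnn.
split=> //; apply: runs_seq; first exact: runs_row_sum.
apply: (@runs_seq _ _ _ _ _ _ _
  (St [:: nr; nc; 1; k; L; N; i; 0; 0; row_val A thr k i.+1 N; best; bestN; 0; 0]%N
     (nth 0 [:: row_sum A k N i; 0; thr]))); last by straight; rewrite /S addn1.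
rewrite /row_val big_ord_recr /=.
apply: runs_if => /=; first by move=> ->; straight.
by move=> /negbTE ->; straight; rewrite addn0.
Qed.

(** * Exhaustive search *)

(** Models registers 10 and 11 after [n] rounds of the search; ties go to the later index, as in the
    test [CNle 10 9]. *)
Fixpoint best_upto (f : nat -> nat) (n : nat) : nat * nat :=
  if n is m.+1 then
    if ((best_upto f m).1 <= f m)%N then (f m, m) else best_upto f m
  else (0, 0)%N.

Lemma best_uptoP f n : (0 < n)%N ->
  [/\ ((best_upto f n).2 < n)%N, f (best_upto f n).2 = (best_upto f n).1 &
    forall m, (m < n)%N -> (f m <= (best_upto f n).1)%N].
Proof.
case: n => // n _; elim: n => [|n [IH1 IH2 IH3]].
  by split=> //; case.
set b := best_upto f n.+1 in IH1 IH2 IH3.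
have -> : best_upto f n.+2 = if (b.1 <= f n.+1)%N then (f n.+1, n.+1) else b by [].
case: (leqP b.1) => h; split=> //=.
  by move=> m; rewrite ltnS leq_eqVlt => /orP[/eqP->|/IH3]; lia.
  by lia.
by move=> m; rewrite ltnS leq_eqVlt => /orP[/eqP->|/IH3]; lia.
Qed.

Definition search_prog (R : realType) : prog R :=
  While (CNlt 5 4) (Seq (value_prog R)
   (Seq (If (CNle 10 9) (block (NAdd R 10 9 13) [:: NAdd R 11 5 13]) (skip R))
      (block (NAdd R 5 5 2) [:: NConst R 9 0]))).

Lemma runs_search {R : realType} {nr nc} (A : 'M[R]_(nr, nc)) k L (thr : R) : (0 < nc)%N ->
  let b := best_upto (row_val A thr k nr) in
  runs A (search_prog R)
    (St [:: nr; nc; 1; k; L; 0; 0; 0; 0; 0; 0; 0; 0; 0]%N (nth 0 [:: 0; 0; thr]))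
    (L * (nr * (k * (3 * L + 8) + 12) + 11)).+1
    (St [:: nr; nc; 1; k; L; L; 0; 0; 0; 0; (b L).1; (b L).2; 0; 0]%N (nth 0 [:: 0; 0; thr])).
Proof.
move=> nc0 b.
pose S N := St [:: nr; nc; 1; k; L; N; 0; 0; 0; 0; (b N).1; (b N).2; 0; 0]%N (nth 0 [:: 0; 0; thr]).
apply: (@runs_leq _ _ _ _ _ _ (L * (nr * (k * (3 * L + 8) + 12) + 5 + (3 + 2)).+1).+1); first by lia.
apply: (@runs_while _ _ _ _ _ _ _ _ S) => [N NL|]; last by rewrite /= ltnn.
split=> //; apply: runs_seq.
  apply: runs_leq (runs_value _ _ _ _ _ _ _ _ nc0).
  by rewrite leq_add2r leq_mul2l leq_add2r leq_mul2l leq_add2r leq_mul2l (ltnW NL) !orbT.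
apply: (@runs_seq _ _ _ _ _ _ _
  (St [:: nr; nc; 1; k; L; N; 0; 0; 0; row_val A thr k nr N; (b N.+1).1; (b N.+1).2; 0; 0]%N
     (nth 0 [:: 0; 0; thr]))); last by straight; rewrite /S addn1.
have -> : b N.+1 = if ((b N).1 <= row_val A thr k nr N)%N
  then (row_val A thr k nr N, N) else b N by [].
apply: runs_if => /= [->|/negbTE->]; straight.
  by rewrite !addn0.
by [].
Qed.

(** * Computing the search parameters *)

(** The first loop doubles register 4 until it exceeds [nr], adding [K] to register 3 each time;
    this yields [k] without multiplication or logarithm. The second builds [nc ^ k] by repeated
    addition. *)
Definition setup_prog {R : realType} (eps : R) (K : nat) : prog R :=
  Seq (block (NConst R 2 1) [:: NConst R 4 1; NConst R 5 K])
  (Seq (While (CNle 4 0) (block (NAdd R 4 4 4) [:: NAdd R 3 3 5]))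
  (Seq (block (NConst R 4 1) [:: NConst R 5 0])
  (Seq (While (CNlt 12 3)
     (Seq (While (CNlt 8 1) (block (NAdd R 7 7 4) [:: NAdd R 8 8 2]))
        (block (NAdd R 4 7 13) [:: NAdd R 12 12 2; NConst R 7 0; NConst R 8 0])))
  (block (NConst R 12 0) [:: RConst 2 (- eps); NtoR R 1 3; RMul R 2 2 1; RConst 1 0])))).

Lemma runs_setup {R : realType} {nr nc} (A : 'M[R]_(nr, nc)) (eps : R) K :
  (0 < nr)%N -> let k := (K * (trunc_log 2 nr).+1)%N in
  runs A (setup_prog eps K)
    (St [:: nr; nc; 0; 0; 0; 0; 0; 0; 0; 0; 0; 0; 0; 0]%N (nth 0 [:: 0; 0; 0]))
    ((trunc_log 2 nr).+1 * 3 + k * (nc * 3 + 6) + 12)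
    (St [:: nr; nc; 1; k; nc ^ k; 0; 0; 0; 0; 0; 0; 0; 0; 0]%N
       (nth 0 [:: 0; 0; - eps * k%:R])).
Proof.
move=> nr0 k; set M := (trunc_log 2 nr).+1.
pose S m := St [:: nr; nc; 1; K * m; 2 ^ m; K; 0; 0; 0; 0; 0; 0; 0; 0]%N (nth (0 : R) [:: 0; 0; 0]).
pose S' t := St [:: nr; nc; 1; k; nc ^ t; 0; 0; 0; 0; 0; 0; 0; t; 0]%N (nth (0 : R) [:: 0; 0; 0]).
apply: (@runs_leq _ _ _ _ _ _
  (3 + ((M * 3).+1 + (2 + ((k * ((nc * 3).+1 + 4).+1).+1 + 5))))); first by lia.
apply: (@runs_seq _ _ _ _ _ _ _ (S 0%N)); first by straight; rewrite /S muln0 expn0.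
apply: (@runs_seq _ _ _ _ _ _ _ (S M)).
  (* Exactly [M] rounds: [2 ^ m <= nr] for [m < M], while [nr < 2 ^ M]. *)
  apply: (@runs_while _ _ _ _ _ _ _ _ S) => [m mM|]; last first.
    by rewrite /= -ltnNge trunc_log_ltn.
  split; last by straight; rewrite /S expnS mul2n -addnn mulnS [(K + _)%N]addnC.
  by rewrite /= (leq_trans _ (trunc_logP (isT : 1 < 2)%N nr0)) // leq_exp2l.
apply: (@runs_seq _ _ _ _ _ _ _ (S' 0%N)); first by straight; rewrite /S' expn0.
apply: (@runs_seq _ _ _ _ _ _ _ (S' k)); last by straight.
apply: (@runs_while _ _ _ _ _ _ _ _ S') => [t tk|]; last by rewrite /= ltnn.
split=> //.
pose S2 u := St [:: nr; nc; 1; k; nc ^ t; 0; 0; u * nc ^ t; u; 0; 0; 0; t; 0]%N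
  (nth (0 : R) [:: 0; 0; 0]).
apply: (@runs_seq _ _ _ _ _ _ _ (S2 nc)); last first.
  by straight; rewrite /S' expnS !addn0 addn1.
apply: (@runs_while _ _ _ _ _ _ _ _ S2) => [u unc|]; last by rewrite /= ltnn.
by split=> //; straight; rewrite /S2 mulSn [(nc ^ t + _)%N]addnC addn1.
Qed.

(** * Writing the digit frequencies *)

Definition digit_count (d k N j : nat) : nat := \sum_(t < k) (digit d N t == j).

(** Equality is tested by two inequalities, since conditions offer only [<=] and [<]. *)
Definition count_prog (R : realType) : prog R :=
  Seq (block (NAdd R 7 5 13) [:: NAdd R 8 5 13])
  (Seq (While (CNlt 12 3) (Seq (divmod_prog R)
     (Seq (If (CNle 7 6) (If (CNle 6 7) (block (NAdd R 9 9 2) [::]) (skip R)) (skip R))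
        (block (NAdd R 7 8 13) [:: NAdd R 12 12 2]))))
  (block (NConst R 7 0) [:: NConst R 8 0; NConst R 12 0])).

(** The real memory [f] is arbitrary and preserved, so counting can alternate with writing
    outputs. *)
Lemma runs_count {R : realType} {nr nc} (A : 'M[R]_(nr, nc)) k L N j h b f : (0 < nc)%N ->
  runs A (count_prog R)
    (St [:: nr; nc; 1; k; L; N; j; 0; 0; 0; h; b; 0; 0]%N f)
    (k * (3 * N + 8) + 6)
    (St [:: nr; nc; 1; k; L; N; j; 0; 0; digit_count nc k N j; h; b; 0; 0]%N f).
Proof.
move=> nc0.
pose S t := St [:: nr; nc; 1; k; L; N; j; N %/ nc ^ t; N %/ nc ^ t;
  digit_count nc t N j; h; b; t; 0]%N f.
apply: (@runs_leq _ _ _ _ _ _ (2 + ((k * (3 * N + 7).+1).+1 + 3))); first by lia.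
apply: (@runs_seq _ _ _ _ _ _ _ (S 0%N)).
  by straight; rewrite /S /St /digit_count big_ord0 expn0 divn1 ?addn0.
apply: (@runs_seq _ _ _ _ _ _ _ (S k)); last by straight.
apply: (@runs_while _ _ _ _ _ _ _ _ S) => [t tk|]; last by rewrite /= ltnn.
split=> //; rewrite {1}/S.
apply: (@runs_leq _ _ _ _ _ _ (3 * (N %/ nc ^ t) + 2 + (3 + 2))).
  by have := leq_div N (nc ^ t); lia.
apply: runs_seq; first exact: runs_divmod.
apply: (@runs_seq _ _ _ _ _ _ _ (St [:: nr; nc; 1; k; L; N; j; (N %/ nc ^ t) %% nc;
  N %/ nc ^ t %/ nc; digit_count nc t.+1 N j; h; b; t; 0]%N f)); last first.
  by straight; rewrite /S expnSr divnMA !addn0 addn1.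
rewrite {2}/digit_count big_ord_recr /= -/(digit_count nc t N j) /digit.
apply: runs_if => /= le1; first apply: runs_if => /= le2.
- by straight; rewrite eqn_leq le1 le2.
- by straight; rewrite eqn_leq (negbTE le2) andbF addn0.
- by apply: (@runs_leq _ _ _ _ _ _ 1) => //; straight; rewrite eqn_leq (negbTE le1) addn0.
Qed.

(* Arithmetic needs the fixed real registers 0 and 1, which are also output
   cells: register 1 is saved at the address h outside the output range and
   restored, and the outputs are produced for decreasing j, so that register 0
   is written last. *)
Definition store_ratio {R : realType} (h j c k : nat) (f : nat -> R) : nat -> R :=
  let f1 := upd (upd (upd f h (f 1%N)) 0%N c%:R) 1%N k%:R in
  let f2 := upd f1 0%N (f1 0%N / f1 1%N) in
  let f3 := upd f2 1%N (f2 h) in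
  upd f3 j (f3 0%N).

Lemma store_ratio_at {R : realType} h j c k (f : nat -> R) :
  store_ratio h j c k f j = c%:R / k%:R.
Proof. by rewrite /store_ratio /upd eqxx. Qed.

Lemma store_ratio_other {R : realType} h j c k (f : nat -> R) x :
  (1 < h)%N -> x != j -> x != 0%N -> x != h -> store_ratio h j c k f x = f x.
Proof.
move=> h1 /negbTE xj /negbTE x0 /negbTE xh; rewrite /store_ratio /upd xj x0 xh.
by have [->|//] := eqVneq x 1%N; case: h h1 {xh} => [|[|h]] //= _; rewrite eqxx.
Qed.

Definition output_prog (R : realType) : prog R :=
  Seq (block (NAdd R 5 11 13) [:: NAdd R 6 1 13; NAdd R 10 1 2])
  (While (CNlt 13 6) (Seq (block (NSub R 6 6 2) [:: NConst R 9 0]) (Seq (count_prog R)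
     (block (RStore R 10 1) [:: NtoR R 0 9; NtoR R 1 3; RDiv R 0 0 1; RLoad R 1 10; RStore R 6 0])))).

Lemma runs_output {R : realType} {nr nc} (A : 'M[R]_(nr, nc)) k L N b f : (0 < nc)%N ->
  exists2 s, runs A (output_prog R)
    (St [:: nr; nc; 1; k; L; L; 0; 0; 0; 0; b; N; 0; 0]%N f)
    (nc * (k * (3 * N + 8) + 15) + 4) s &
    forall j, (j < nc)%N -> rmem s j = (digit_count nc k N j)%:R / k%:R.
Proof.
move=> nc0.
(* [F i] is the real memory once the cells [nc - 1] down to [nc - i] are written. *)
pose F := fix F i := if i is i'.+1 then
  store_ratio nc.+1 (nc - i) (digit_count nc k N (nc - i)) k (F i') else f.
pose S i := St [:: nr; nc; 1; k; L; N; nc - i; 0; 0;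
  if i is 0 then 0 else digit_count nc k N (nc - i); nc.+1; N; 0; 0]%N (F i).
exists (S nc); last first.
  suff H i j : (i <= nc)%N -> (nc - i <= j < nc)%N ->
      F i j = (digit_count nc k N j)%:R / k%:R.
    by move=> j jnc; apply: H => //; rewrite subnn.
  elim: i => [|i IH] ile /andP[j1 j2]; first by lia.
  have [->|jne] := eqVneq j (nc - i.+1)%N; first exact: store_ratio_at.
  (* A cell written earlier satisfies [nc - i.+1 < j < nc], so it is neither the accumulator 0 nor
     the save address [nc.+1]. *)
  rewrite [LHS]store_ratio_other //; try lia.
  by apply: IH; lia.
apply: (@runs_leq _ _ _ _ _ _ (3 + (nc * (2 + (k * (3 * N + 8) + 6 + 6)).+1).+1)); first by lia.
apply: (@runs_seq _ _ _ _ _ _ _ (S 0%N)).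
  by straight; rewrite /S !addn0 addn1 subn0.
apply: (@runs_while _ _ _ _ _ _ _ _ S) => [i inc|]; last by rewrite /= subnn.
split; first by rewrite /= subn_gt0.
apply: (@runs_seq _ _ _ _ _ _ _ (St [:: nr; nc; 1; k; L; N; nc - i.+1; 0; 0;
  0; nc.+1; N; 0; 0]%N (F i))); first by straight; rewrite /St -subnDA addn1.
apply: runs_seq; first exact: runs_count.
by straight.
Qed.

(** * Correctness of the search over digit sequences *)

Lemma digit_ltn d N t : (0 < d)%N -> (digit d N t < d)%N.
Proof. exact: ltn_pmod. Qed.

(** As in Horner's scheme, [g 0] is appended as the lowest digit to the code of the shifted
    sequence. Hence the counter misses no column sequence. *)
Lemma digits_surj d k (g : nat -> nat) : (0 < d)%N -> (forall t, g t < d)%N ->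
  exists2 N, (N < d ^ k)%N & forall t, (t < k)%N -> digit d N t = g t.
Proof.
move=> d0; elim: k g => [|k IH] g gd; first by exists 0%N.
have [N NL Ng] := IH (fun t => g t.+1) (fun t => gd t.+1).
have gN : ((N * d + g 0) %/ d = N)%N by rewrite divnMDl // divn_small // addn0.
exists (N * d + g 0)%N.
  rewrite expnSr; apply: (@leq_trans (N.+1 * d)); last by rewrite leq_mul2r NL orbT.
  by rewrite mulSn addnC ltn_add2r.
case=> [_|t tk]; first by rewrite /digit expn0 divn1 modnMDl modn_small.
by rewrite /digit expnS divnMA gN; apply: Ng.
Qed.

(** Regroups the [k] picks by column. A constant [F] yields the total weight, and [F = entry A i]
    yields the row sum. *)
Lemma sum_digit_count {R : realType} d k N (F : nat -> R) : (0 < d)%N ->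
  \sum_(j < d) F j * (digit_count d k N j)%:R = \sum_(t < k) F (digit d N t).
Proof.
move=> d0; rewrite /digit_count.
under eq_bigr do rewrite natr_sum mulr_sumr.
rewrite exchange_big; apply: eq_bigr => t _ /=.
have dt := digit_ltn d N t d0.
rewrite (bigD1 (Ordinal dt)) //= eqxx mulr1 big1 ?addr0 // => j jn.
by rewrite (_ : _ == _ = false) ?mulr0 //; apply: contraNF jn => /eqP h; apply/eqP/val_inj.
Qed.

Lemma entryE {R : realType} {nr nc} (A : 'M[R]_(nr, nc)) (i : 'I_nr) (j : 'I_nc) :
  entry A i j = A i j.
Proof. by rewrite /entry !valK. Qed.

Lemma nsat_sum {R : realType} {nr nc} (A : 'M[R]_(nr, nc)) x eps :
  nsat A x eps = (\sum_(i < nr) (- eps <= mxapp A x i)%R)%N.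
Proof.
rewrite /nsat -sum1_card big_mkcond; apply: eq_bigr => i _.
by rewrite inE; case: (_ <= _).
Qed.

Lemma best_digits_solution {R : realType} {nr nc} (A : 'M[R]_(nr, nc)) (eps : R) k :
  (0 < nc)%N -> (0 < k)%N ->
  (forall y, in_simplex y -> exists g : nat -> 'I_nc,
    forall i, (mxapp A y i - eps) * k%:R <= \sum_(t < k) A i (g t)) ->
  let N := (best_upto (row_val A (- eps * k%:R) k nr) (nc ^ k)).2 in
  eps_MFS_solution A eps (fun j => (digit_count nc k N j)%:R / k%:R).
Proof.
move=> nc0 k0 sparse N.
have kn0 : (0 : R) < k%:R by rewrite ltr0n.
have L0 : (0 < nc ^ k)%N by rewrite expn_gt0 nc0.
have [_ valN maxN] := best_uptoP (row_val A (- eps * k%:R) k nr) _ L0.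
rewrite -/N in valN; split.
  split=> [j|]; first by rewrite divr_ge0 ?ler0n.
  under eq_bigr do rewrite -[(digit_count _ _ _ _)%:R]mul1r.
  by rewrite -mulr_suml (sum_digit_count _ _ _ (fun=> 1)) // sumr_const card_ord divff ?gt_eqF.
move=> y hy; have [g hg] := sparse y hy.
have [M ML Mg] := digits_surj nc k (fun t => g t) nc0 (fun t => ltn_ord (g t)).
have -> : nsat A (fun j => (digit_count nc k N j)%:R / k%:R) eps
    = row_val A (- eps * k%:R) k nr N.
  rewrite nsat_sum; apply: eq_bigr => i _; congr nat_of_bool.
  rewrite -ler_pdivlMr // /row_sum -(sum_digit_count nc k N (entry A i)) // mulr_suml.
  by congr (_ <= _); apply: eq_bigr => j _; rewrite entryE mulrA.
(* It remains to compare [y] with the candidate [M] coding its sparse sequence: a row with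
   [0 <= mxapp A y i] has row sum at least [- eps * k]. *)
rewrite valN; apply: leq_trans (maxN _ ML).
rewrite nsat_sum; apply: leq_sum => i _.
case: (boolP (- 0 <= mxapp A y i)) => // wi; rewrite lt0b.
rewrite /row_sum (eq_bigr (fun t : 'I_k => A i (g t))); last first.
  by move=> t _; rewrite Mg // entryE.
by apply: le_trans (hg i); rewrite ler_pM2r //; move: wi; rewrite oppr0; lra.
Qed.

(** * The complete program and its running time *)

Lemma init_stateE (R : realType) nr nc : init_state R nr nc =
  St [:: nr; nc; 0; 0; 0; 0; 0; 0; 0; 0; 0; 0; 0; 0]%N (nth 0 [:: 0; 0; 0]).
Proof.
by congr State; apply/funext; do 3 (case=> //); do 11 (case=> //); move=> n /=; rewrite nth_nil.
Qed.

(** Register 13 is initially 0, so the first test detects [nr = 0]. *)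
Definition mfs_prog {R : realType} (eps : R) (K : nat) : prog R :=
  If (CNle 0 13) (block (RConst 0 1) [::])
    (Seq (setup_prog eps K) (Seq (search_prog R) (output_prog R))).

(** All of [nr], [nc], [M], [k], [L], [N] are at most [B = n ^ (2 * K * l)], and the time is a
    quartic in them, hence at most [2 ^ 7 * B ^ 4]. Here [2 ^ 7 <= n ^ (7 * l)] and
    [B ^ 4 = n ^ (8 * K * l)]. *)
Lemma running_time_bound K nr nc N : (0 < K)%N -> (0 < nr)%N -> (0 < nc)%N ->
  let M := (trunc_log 2 nr).+1 in let k := (K * M)%N in let L := (nc ^ k)%N in
  (N < L)%N ->
  ((M * 3 + k * (nc * 3 + 6) + 12 + ((L * (nr * (k * (3 * L + 8) + 12) + 11)).+1 +
     (nc * (k * (3 * N + 8) + 15) + 4))).+1 <=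
   (nr * nc).+2 ^ ((7 + 8 * K) * trunc_log 2 (nr * nc).+2))%N.
Proof.
move=> K0 nr0 nc0 M k L NL; set n := (nr * nc).+2; set l := trunc_log 2 n.
have nrn : (nr <= n)%N by rewrite /n; nia.
have ncn : (nc <= n)%N by rewrite /n; nia.
have l0 : (0 < l)%N by apply: (@trunc_log_max 2 n 1).
have Ml : (M <= 2 * l)%N.
  have : (trunc_log 2 nr <= l)%N by apply: leq_trunc_log.
  by rewrite /M; lia.
pose B := (n ^ (2 * K * l))%N.
have kl : (k <= 2 * K * l)%N by rewrite /k; nia.
have kB : (k <= B)%N.
  apply: leq_trans kl _; apply: ltnW; exact: ltn_expl.
have MB : (M <= B)%N by apply: leq_trans kB; rewrite /k leq_pmull.
have nB : (n <= B)%N by rewrite -[leqLHS]expn1 leq_exp2l // muln_gt0 l0 muln_gt0 K0.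
have LB : (L <= B)%N.
  apply: (@leq_trans (n ^ k)); first by rewrite leq_exp2r // muln_gt0 K0.
  by rewrite leq_exp2l.
have B1 : (0 < B)%N by rewrite expn_gt0.
apply: (@leq_trans (2 ^ 7 * B ^ 4)); last first.
  rewrite mulnDl expnD leq_mul //.
    apply: (@leq_trans (n ^ 7)); first by rewrite leq_exp2r.
    by rewrite leq_exp2l //; lia.
  by rewrite -expnM leq_exp2l //; lia.
apply: (@leq_trans (B * 3 + B * (B * 3 + 6) + 12 + ((B * (B * (B * (3 * B + 8) + 12) + 11)).+1 +
     (B * (B * (3 * B + 8) + 15) + 4))).+1).
  have nrB := leq_trans nrn nB; have ncB := leq_trans ncn nB.
  have NB := leq_trans (ltnW NL) LB.
  by rewrite ltnS; repeat (apply: leq_add => // || apply: leq_mul => // || rewrite ltnS).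
(* With [B = b.+1] the two polynomials in [b] compare coefficient by coefficient. *)
move: B1; case: (B) => // b _; rewrite !expnS expn0; nia.
Qed.

Theorem theorem4 (R : realType) (eps : R) (heps : 0 < eps) :
  exists (P : prog R) (C : nat),
  forall (nr nc : nat) (A : 'M[R]_(nr, nc)),
    (0 < nc)%N ->
    (forall i j, -1 <= A i j <= 1) ->
    exists (t : nat) (s' : state R),
      exec A P (init_state R nr nc) t s' /\
      (t <= (nr * nc).+2 ^ (C * trunc_log 2 (nr * nc).+2))%N /\
      eps_MFS_solution A eps (fun j : 'I_nc => rmem s' j).
Proof.
(* Capping at 1 meets the hypothesis of [sparse_sequence]; a loss of [e <= eps] is still allowed. *)
pose e := Num.min eps 1.
have he : 0 < e <= 1 by rewrite lt_min heps ltr01 ge_min lexx orbT.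
have [|K K0 hK] := expn_decay_rate (1 - e ^+ 2 / 32).
  by move: he => /andP[]; nra.
exists (mfs_prog eps K), (7 + 8 * K)%N => nr nc A nc0 hA.
rewrite init_stateE.
(* If nr = 0 the time bound is a constant whatever nc is, hence the separate
   branch returning the first unit vector. *)
have [nr0|nr0] := posnP nr.
  move: A hA; rewrite nr0 mul0n => A hA.
  have [t tT ex] : runs A (mfs_prog eps K)
      (St [:: 0; nc; 0; 0; 0; 0; 0; 0; 0; 0; 0; 0; 0; 0]%N (nth 0 [:: 0; 0; 0])) 2
      (St [:: 0; nc; 0; 0; 0; 0; 0; 0; 0; 0; 0; 0; 0; 0]%N (nth 0 [:: 1; 0; 0])).
    by apply: runs_if => // _; straight.
  exists t; eexists; split; first exact: ex; split.
    apply: leq_trans tT _; rewrite (_ : trunc_log 2 2 = 1%N) // muln1.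
    by rewrite -[leqLHS]expn1 leq_exp2l.
  split; last by move=> y _; rewrite !nsat_sum !big_ord0.
  split=> [j|].
    by case: j => -[|[|[|j]]] jn //=; rewrite ?nth_nil.
  case: nc nc0 A hA ex => // nc _ A hA ex.
  by rewrite big_ord_recl /= big1 ?addr0 // => -[[|[|j]] jn] _ //=; rewrite nth_nil.
set k := (K * (trunc_log 2 nr).+1)%N.
have k0 : (0 < k)%N by rewrite muln_gt0 K0.
pose b := best_upto (row_val A (- eps * k%:R) k nr) (nc ^ k).
pose N := b.2.
have L0 : (0 < nc ^ k)%N by rewrite expn_gt0 nc0.
have [NL _ _] := best_uptoP (row_val A (- eps * k%:R) k nr) _ L0.
have [s out hs] := runs_output A k (nc ^ k) N b.1 (nth 0 [:: 0; 0; - eps * k%:R]) nc0.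
have [t tT ex] := runs_seq _ _ _ _ _ _ _ _ (runs_setup A eps K nr0)
  (runs_seq _ _ _ _ _ _ _ _ (runs_search A k (nc ^ k) (- eps * k%:R) nc0) out).
exists t.+1, s; split; first by apply: ExIfF => //=; rewrite -ltnNge.
split; first exact: leq_ltn_trans tT (running_time_bound K nr nc N K0 nr0 nc0 NL).
suff <- : (fun j : 'I_nc => (digit_count nc k N j)%:R / k%:R) = (fun j : 'I_nc => rmem s j).
  apply: best_digits_solution => // y hy.
  have [|g hg] := sparse_sequence A y e k hA hy he k0; last first.
    exists g => i; apply: le_trans (hg i); rewrite ler_pM2r ?ltr0n //.
    by rewrite lerD2l lerN2 ge_min lexx.
  (* Each block of [K] columns halves the bound, and [(trunc_log 2 nr).+1] halvings bring [nr] below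
     1. *)
  rewrite exprM; apply: (@le_lt_trans _ _ (nr%:R * 2^-1 ^+ (trunc_log 2 nr).+1)).
    by rewrite ler_pM2l ?ltr0n // lerXn2r ?nnegrE ?exprn_ge0 //; nra.
  by rewrite exprVn ltr_pdivrMr ?exprn_gt0 // mul1r -natrX ltr_nat trunc_log_ltn.
by apply/funext => j; rewrite hs.
Qed.
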